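(* Let $dX_t=\mu_t\,dt+\sigma_t\,dB_t$ on $[0,T]$, where $(\mu,\sigma)$ satisfies the non-leverage condition, the moment bound, and the scaling condition with data $(\gamma,L,C_\gamma)$, let $K$ be an admissible kernel for $(\gamma,C_\gamma)$, and let $\tau\in(0,T)$ with $\mathbb E[\sigma_\tau^4]>0$. For $n\in\mathbb N$ and $h>0$ define the approximated MSE $$\mathrm{MSE}^a_{\tau,n,h}=2\frac{T}{nh}\mathbb E[\sigma_\tau^4]\int K^2(x)dx+h^\gamma L(\tau)\iint K(x)K(y)C_\gamma(x,y)dxdy .$$ Then the bandwidth minimizing $h\mapsto \mathrm{MSE}^a_{\tau,n,h}$ over $h>0$ is $$h_n^{a,opt}=n^{-1/(\gamma+1)}\left[\frac{2T\,\mathbb E[\sigma_\tau^4]\int K^2(x)dx}{\gamma L(\tau)\iint K(x)K(y)C_\gamma(x,y)dxdy}\right]^{1/(\gamma+1)},$$ and the attained global minimum is $$n^{-\gamma/(1+\gamma)}\Big(1+\frac1\gamma\Big)\Big(2T\,\mathbb E[\sigma_\tau^4]\int K^2(x)dx\Big)^{\gamma/(1+\gamma)}\Big(\gamma L(\tau)\iint K(x)K(y)C_\gamma(x,y)dxdy\Big)^{1/(1+\gamma)}.$$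
   Context: Setting. On a complete filtered probability space $(\Omega,\mathscr F,\mathbb F=\{\mathscr F_t\}_{t\ge0},\mathbb P)$, $\mu,\sigma$ are $\mathbb F$-adapted processes and $B$ is a standard Brownian motion adapted to $\mathbb F$. Non-leverage condition: $(\mu,\sigma)$ is independent of $B$. Moment bound: there is $M_T>1$ with $\mathbb E[\mu_t^4+\sigma_t^4]<M_T$ for all $t\in[0,T]$. Scaling condition with data $(\gamma,L,C_\gamma)$: $\gamma>0$, $L$ is a (strictly) positive function of $t$, $C_\gamma:\mathbb R\times\mathbb R\to\mathbb R$ is not identically zero and satisfies $C_\gamma(hr,hs)=h^\gamma C_\gamma(r,s)$ for all $r,s\in\mathbb R$, $h>0$; and $V_t=\sigma_t^2$ satisfies, for each $t\in(0,T)$, $\mathbb E[(V_{t+r}-V_t)(V_{t+s}-V_t)]=L(t)C_\gamma(r,s)+o((r^2+s^2)^{\gamma/2})$ as $r,s\to0$. Admissible kernel for $(\gamma,C_\gamma)$: $K:\mathbb R\to\mathbb R$ such that (1) $\int K(x)dx=1$; (2) $K$ is Lipschitz and piecewise $C^1$ on its support $(A,B)$, where $-\infty\le A<0<B\le\infty$; (3) $\int|K(x)||x|^\gamma dx<\infty$, $K(x)x^{\gamma+1}\to0$ as $|x|\to\infty$, $\int|K'(x)|dx<\infty$, and the total variation of $|K'|$ over $(-\infty,\infty)$ is finite; (4) $\iint K(x)K(y)C_\gamma(x,y)dxdy>0$. *)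

(* Defs.v *)
From HB Require Import structures.
From mathcomp Require Import all_boot all_order all_algebra.
From mathcomp Require Import all_classical all_reals all_analysis.

Set Implicit Arguments.
Unset Strict Implicit.
Unset Printing Implicit Defensive.

Import Order.TTheory GRing.Theory Num.Theory.
Import numFieldNormedType.Exports.

Local Open Scope classical_set_scope.
Local Open Scope ring_scope.

(* Processes and filtrations are functions on R of which only the values at
   times t >= 0 are constrained. *)

Section StochasticBasis.
Context (d : measure_display) (Omega : measurableType d) (R : realType).
Variables (P : probability Omega R) (F : R -> set (set Omega)).
Implicit Types X B mu sigma I : R -> Omega -> R.

Definition complete_filtration : Prop :=
  [/\ forall t, 0 <= t -> sigma_algebra setT (F t),
      forall t, 0 <= t -> F t `<=` measurable,
      forall s t, 0 <= s -> s <= t -> F s `<=` F t &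
      (* every subset of a null event belongs to F 0, so that P is complete *)
      forall N, P.-negligible N -> F 0 N].

Definition adapted X : Prop :=
  forall t, 0 <= t -> forall S, measurable S -> F t (X t @^-1` S).

Definition brownian_motion B : Prop :=
  [/\ adapted B,
      {ae P, forall w, B 0 w = 0},
      {ae P, forall w, {within `[0, +oo[, continuous (fun t => B t w)}},
      forall s t, 0 <= s -> s < t -> forall S : set R, measurable S ->
        P ((B t \- B s) @^-1` S) = normal_prob 0 (Num.sqrt (t - s)) S &
      forall s t, 0 <= s -> s < t ->
        forall A (S : set R), F s A -> measurable S ->
        P (A `&` (B t \- B s) @^-1` S) = (P A * P ((B t \- B s)%R @^-1` S))%E].

Definition process_events X : set (set Omega) :=
  [set A | exists t S, [/\ 0 <= t, measurable S & A = X t @^-1` S]].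

(* sigma(mu_t, sigma_t : t >= 0) and sigma(B_t : t >= 0) are independent. *)
Definition non_leverage mu sigma B : Prop :=
  forall A C, <<s process_events mu `|` process_events sigma >> A ->
    <<s process_events B >> C -> P (A `&` C) = (P A * P C)%E.

Definition moment_bound (T : R) mu sigma : Prop :=
  exists2 M : R, 1 < M & forall t, t \in `[0, T] ->
    ('E_P[fun w => (mu t w ^+ 4 + sigma t w ^+ 4)%R] < M%:E)%E.

(* The process \sum_(i < sp_size) sp_coef i * 1_{]sp_time i, sp_time i.+1]}. *)
Record simple_process := SimpleProcess {
  sp_size : nat;
  sp_time : nat -> R;
  sp_coef : nat -> Omega -> R }.

Definition simple_adapted (H : simple_process) : Prop :=
  [/\ 0 <= sp_time H 0,
      forall i, (i < sp_size H)%N -> sp_time H i <= sp_time H i.+1,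
      forall i, (i < sp_size H)%N -> forall S, measurable S ->
        F (sp_time H i) (sp_coef H i @^-1` S) &
      exists M, forall i w, (i < sp_size H)%N -> `|sp_coef H i w| <= M].

Definition sp_val (H : simple_process) (t : R) (w : Omega) : R :=
  \sum_(i < sp_size H)
    sp_coef H i w * (t \in `]sp_time H i, sp_time H i.+1])%:R.

Definition sp_int B (H : simple_process) (t : R) (w : Omega) : R :=
  \sum_(i < sp_size H) sp_coef H i w *
    (B (Num.min t (sp_time H i.+1)) w - B (Num.min t (sp_time H i)) w).

(* I is (a continuous version of) the stochastic integral of sigma against the
   Brownian motion B on [0, T]: simple adapted processes H k satisfy
   \int_0^T (H k - sigma)^2 ds --> 0 in probability, and their elementary
   integrals converge to I in probability. *)
Definition is_ito_integral B (T : R) sigma I : Prop :=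
  {ae P, forall w, {within `[0, T], continuous (fun t => I t w)}} /\
  exists H : nat -> simple_process,
    [/\ forall k, simple_adapted (H k),
        forall e : R, 0 < e ->
          P [set w | (e%:E <= \int[lebesgue_measure]_(s in `[0%R, T])
                       ((sp_val (H k) s w - sigma s w) ^+ 2)%:E)%E]
            @[k --> \oo] --> 0%E &
        forall t, t \in `[0, T] -> forall e : R, 0 < e ->
          P [set w | e <= `|sp_int B (H k) t w - I t w|]
            @[k --> \oo] --> 0%E].

Definition measurable_process (T : R) X : Prop :=
  measurable_fun (`[0, T] `*` [set: Omega]) (fun p : R * Omega => X p.1 p.2).

(* dX_t = mu_t dt + sigma_t dB_t on [0, T]. *)
Definition ito_process B (T : R) mu sigma X : Prop :=
  [/\ forall t, t \in `[0, T] ->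
        forall S, measurable S -> F t (X t @^-1` S),
      measurable_process T mu,
      measurable_process T sigma,
      {ae P, forall w, (@lebesgue_measure R).-integrable `[0, T]
                         (fun s => (mu s w)%:E)} &
      exists2 I, is_ito_integral B T sigma I &
        {ae P, forall w, forall t, t \in `[0, T] ->
          X t w = X 0 w + \int[lebesgue_measure]_(s in `[0, t]) mu s w
                  + I t w}].

(* The expectation is finite for r, s near 0 under the moment bound. *)
Definition scaling_condition (T : R) sigma (gamma : R) (L : R -> R)
    (C : R -> R -> R) : Prop :=
  let V t w := sigma t w ^+ 2 in
  [/\ 0 < gamma,
      forall t, t \in `]0, T[ -> 0 < L t,
      exists r s, C r s != 0,
      forall r s h, 0 < h -> C (h * r) (h * s) = h `^ gamma * C r s &
      forall t, t \in `]0, T[ ->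
        (fun p : R * R =>
           fine 'E_P[fun w => ((V (t + p.1) w - V t w)
                               * (V (t + p.2) w - V t w))%R]
           - L t * C p.1 p.2)
        =o_ (nbhs (0 : R * R)%R)
        (fun p : R * R => (p.1 ^+ 2 + p.2 ^+ 2) `^ (gamma / 2))].

End StochasticBasis.

Section Kernel.
Context (R : realType).
Notation leb := (@lebesgue_measure R).

Definition ereal_itv (A B : \bar R) : set R :=
  [set x | (A < x%:E)%E /\ (x%:E < B)%E].

Definition piecewise_C1 (S : set R) (K : R -> R) : Prop :=
  exists s : seq R,
    (forall x, S x -> x \notin s ->
       derivable K x 1 /\ {for x, continuous (derive1 K)}) /\
    (forall x, S x -> x \in s ->
       cvg (derive1 K y @[y --> x^'-]) /\ cvg (derive1 K y @[y --> x^'+])).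

Definition kernel_form (K : R -> R) (C : R -> R -> R) : R :=
  \int[(leb \x leb)%E]_p (K p.1 * K p.2 * C p.1 p.2).

(* derive1 K takes arbitrary values at the finitely many points where K is not
   differentiable (breakpoints and finite endpoints of the support); neither
   its integral nor the finiteness of its variation depends on them.
   For x < 0 the decay condition K(x) x^(gamma+1) --> 0 is read with |x|. *)
Definition admissible_kernel (gamma : R) (C : R -> R -> R) (K : R -> R)
    : Prop :=
  [/\ (\int[leb]_x (K x)%:E = 1)%E,
      exists A B : \bar R,
        [/\ (A < 0)%E, (0 < B)%E,
            closure [set x | K x != 0] = closure (ereal_itv A B),
            [lipschitz K x | x in ereal_itv A B] &
            piecewise_C1 (ereal_itv A B) K],
      [/\ (\int[leb]_x (`|K x| * `|x| `^ gamma)%R%:E < +oo)%E,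
          K x * `|x| `^ (gamma + 1) @[x --> +oo] --> 0
            /\ K x * `|x| `^ (gamma + 1) @[x --> -oo] --> 0,
          (\int[leb]_x (`|derive1 K x|%R)%:E < +oo)%E &
          (ereal_sup [set total_variation ab.1 ab.2
                          (fun x => (`|derive1 K x|)%R) |
                      ab in [set ab : R * R | (ab.1 <= ab.2)%R]] < +oo)%E] &
      0 < kernel_form K C].

End Kernel.

Definition approx_MSE (d : measure_display) (Omega : measurableType d)
    (R : realType) (P : probability Omega R) (T : R) (sigma : R -> Omega -> R)
    (gamma : R) (L : R -> R) (C : R -> R -> R) (K : R -> R) (tau : R)
    (n : nat) (h : R) : R :=
  2 * (T / (n%:R * h)) * fine 'E_P[fun w => (sigma tau w ^+ 4)%R]
    * \int[lebesgue_measure]_x (K x ^+ 2)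
  + h `^ gamma * L tau * kernel_form K C.

(* Main.v *)
Require Import Defs.
From HB Require Import structures.
From mathcomp Require Import all_boot all_order all_algebra.
From mathcomp Require Import all_classical all_reals all_analysis.
From mathcomp Require Import ring lra.
From mathcomp Require Import measurable_realfun.

Import Order.TTheory GRing.Theory Num.Theory.
Import numFieldNormedType.Exports.

Local Open Scope classical_set_scope.
Local Open Scope ring_scope.

(* Up to the substitution h = h0 * t, with h0 the critical point, the objective
   p / h + (b / gamma) h^gamma is a positive multiple of
   t^-1 + t^gamma / gamma; writing t = exp u, the strict inequality
   1 + x < exp x at x = - u and x = gamma u gives the unique minimum t = 1.
   It remains to see that p is positive and finite.  The moment bound controls
   E[sigma^4].  For the square of the kernel, K is bounded on compact sets
   (Lipschitz on its support) and |K x| <= |x|^gamma for large |x| by the decay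
   condition, so K^2 is integrable; and it is not a.e. zero since K has
   integral 1. *)

Set Implicit Arguments.

(** * The normalized one-variable inequality *)

Lemma inv_add_powR_gt (R : realType) (g t : R) : 0 < g -> 0 < t -> t != 1 ->
  1 + g^-1 < t^-1 + g^-1 * t `^ g.
Proof.
move=> g0 t0 t1; have tE : expR (ln t) = t by exact: lnK.
have u0 : ln t != 0 by rewrite ln_eq0.
have lt1 : 1 + - ln t < expR (- ln t) by apply: expR_gt1Dx; rewrite oppr_eq0.
have lt2 : 1 + ln t * g < expR (ln t * g).
  by apply: expR_gt1Dx; rewrite mulf_neq0// gt_eqF.
rewrite expRN tE in lt1; rewrite expRM tE in lt2.
(* With weights [1] and [g^-1] the terms linear in [ln t] cancel. *)
have -> : 1 + g^-1 = (1 + - ln t) + g^-1 * (1 + ln t * g).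
  by field; rewrite gt_eqF.
by rewrite ltrD// ltr_pM2l// invr_gt0.
Qed.

(** * Minimizer and minimum of the two-term objective *)

Section Bandwidth.
Context (R : realType) (g p b : R).
Hypotheses (g0 : 0 < g) (p0 : 0 < p) (b0 : 0 < b).
Let h0 := (p / b) `^ (1 / (g + 1)).
Let f h := p / h + b / g * h `^ g.

Let h0_gt0 : 0 < h0. Proof. by rewrite powR_gt0// divr_gt0. Qed.

(* The first-order condition [f' h0 = 0]. *)
Let h0_critical : b * h0 `^ g = p / h0.
Proof.
have h0X : h0 `^ g * h0 = p / b.
  rewrite mulrC -{1}(powRr1 (ltW h0_gt0)) -powRD; last first.
    by rewrite (gt_eqF h0_gt0) /= implybT.
  rewrite -powRrM addrC mul1r mulVf ?powRr1 ?ltW ?divr_gt0//.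
  by rewrite gt_eqF// addr_gt0.
apply: (mulIf (lt0r_neq0 h0_gt0)); rewrite divfK ?gt_eqF//.
by rewrite -mulrA h0X mulrC divfK// gt_eqF.
Qed.

(** Criticality turns the coefficient [b / g * h0 ^ g] of the power term into [p / h0 / g], so both
    terms share the factor [p / h0]. *)
Let f_h0M t : 0 < t -> f (h0 * t) = p / h0 * (t^-1 + g^-1 * t `^ g).
Proof.
move=> t0; rewrite /f powRM ?ltW// mulrDr -{2}h0_critical.
by field; rewrite !gt_eqF.
Qed.

Let f_h0 : f h0 = p / h0 * (1 + g^-1).
Proof. by rewrite -{1}[h0]mulr1 f_h0M// powR1 invr1 mulr1. Qed.

Lemma bandwidth_min h : 0 < h -> h != h0 -> f h0 < f h.
Proof.
move=> h_gt0 hh0; have hE : h = h0 * (h / h0) by field; rewrite gt_eqF.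
have t0 : 0 < h / h0 by rewrite divr_gt0.
rewrite hE f_h0M// f_h0 ltr_pM2l ?divr_gt0//; apply: inv_add_powR_gt => //.
by apply: contra hh0 => /eqP t1; rewrite hE t1 mulr1.
Qed.

Lemma bandwidth_min_value :
  f h0 = (1 + 1 / g) * p `^ (g / (1 + g)) * b `^ (1 / (1 + g)).
Proof.
have g1 : 1 + g != 0 by rewrite gt_eqF// addr_gt0.
rewrite f_h0 div1r [LHS]mulrC -mulrA; congr (_ * _).
(* What remains is [p / h0]: the exponent of [p] becomes 1 - 1/(g+1) = g/(1+g), and the two minus
   signs on [b] cancel. *)
rewrite /h0 -powRN powRM ?invr_ge0 ?ltW// -(powR_inv1 (ltW b0)) -powRrM.
rewrite mulrA -{1}(powRr1 (ltW p0)) -powRD; last first.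
  by rewrite (gt_eqF p0) /= implybT.
by congr (_ `^ _ * _ `^ _); field; rewrite // addrC.
Qed.

End Bandwidth.

(** * Regularity of the kernel and the integral of its square *)

Lemma ereal_itv_open (R : realType) (A B : \bar R) : open (ereal_itv A B).
Proof. by apply: openI; [exact: open_ereal_gt|exact: open_ereal_lt]. Qed.

(* For an infinite endpoint, [fine] gives the harmless junk value 0. *)
Lemma closure_ereal_itv (R : realType) (A B : \bar R) (x : R) :
  closure (ereal_itv A B) x ->
  x \in [:: fine A; fine B] \/ ereal_itv A B x.
Proof.
move=> clx; have leAx : (A <= x%:E)%E.
  rewrite leNgt; apply/negP => xA.
  have xN : nbhs x [set y | (y%:E < A)%E].
    by apply: open_nbhs_nbhs; split=> //; exact: open_ereal_lt.
  have [y [[Ay _] /= yA]] := clx _ xN.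
  by have := lt_trans Ay yA; rewrite ltxx.
have lexB : (x%:E <= B)%E.
  rewrite leNgt; apply/negP => Bx.
  have xN : nbhs x [set y | (B < y%:E)%E].
    by apply: open_nbhs_nbhs; split=> //; exact: open_ereal_gt.
  have [y [[_ yB] /= By]] := clx _ xN.
  by have := lt_trans By yB; rewrite ltxx.
rewrite !inE.
have [->|Ax] := eqVneq A x%:E; first by left; rewrite eqxx.
have [->|Bx] := eqVneq B x%:E; first by left; rewrite eqxx orbT.
by right; split; rewrite lt_neqAle ?Ax ?leAx// eq_sym Bx.
Qed.

Section KernelSquare.
Context (R : realType) (K : R -> R) (A B : \bar R).
Notation leb := (@lebesgue_measure R).
Hypotheses (A0 : (A < 0)%E) (B0 : (0 < B)%E).
Hypothesis suppK : closure [set x | K x != 0] = closure (ereal_itv A B).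
Hypothesis lipK : [lipschitz K x | x in ereal_itv A B].

(** The Lipschitz hypothesis covers only the open interval, so the values of [K] at finite endpoints
    have to be treated separately. *)
Let K_cases x : [\/ x \in [:: fine A; fine B], ereal_itv A B x | K x = 0].
Proof.
have [|Kx] := eqVneq (K x) 0; first by constructor 3.
have /closure_ereal_itv[] : closure (ereal_itv A B) x.
- by rewrite -suppK; exact: subset_closure.
- by constructor 1.
- by constructor 2.
Qed.

Let K_lip : exists2 k, 0 < k & k.-lipschitz_(ereal_itv A B) K.
Proof.
(* Every constant above [k0] is a Lipschitz constant; this one is also positive. *)
move: lipK => [k0 [k0R klip]]; exists (Num.max 0 k0 + 1).
  by rewrite ltr_wpDl// le_max lexx.
by apply: klip; rewrite ltr_pwDr// le_max lexx orbT.
Qed.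

Let K_continuous : {in ereal_itv A B, continuous K}.
Proof.
have [k k0 lipk] := K_lip.
move=> x; rewrite inE => Sx.
have nS : nbhs x (ereal_itv A B).
  by apply: open_nbhs_nbhs; split=> //; exact: ereal_itv_open.
apply/cvgrPdist_le => e e0; near=> t.
have St : ereal_itv A B t by near: t; exact: nS.
have /= lipxt := lipk (x, t) (conj Sx St).
apply: le_trans lipxt _; rewrite mulrC -ler_pdivlMr//.
by near: t; apply: cvgr_dist_le; [exact: cvg_id|rewrite divr_gt0].
Unshelve. all: by end_near. Qed.

(** Since [A < 0 < B], the point 0 lies in the interval and [K x] can be compared with [K 0]; the
    endpoint values are absorbed into the constant. *)
Lemma lipschitz_kernel_growth :
  exists c k : R, [/\ 0 <= c, 0 <= k & forall x, `|K x| <= c + k * `|x|].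
Proof.
have [k k0 lipk] := K_lip.
exists (`|K 0| + `|K (fine A)| + `|K (fine B)|), k; split; rewrite ?(ltW k0)//.
move=> x; have kx : 0 <= k * `|x| by rewrite mulr_ge0// ltW.
have := normr_ge0 (K 0); have := normr_ge0 (K (fine A)).
have := normr_ge0 (K (fine B)) => Kb Ka K0.
have [|Sx|->] := K_cases x; last by rewrite normr0; lra.
  by rewrite !inE => /orP[] /eqP xE; rewrite xE in kx *; lra.
have /= := lipk (x, 0) (conj Sx (conj A0 B0)); rewrite subr0 => lipx.
by have := ler_normD (K x - K 0) (K 0); rewrite subrK; lra.
Qed.

(** The line splits into the open interval, where [K] is continuous, a set of at most two points,
    all of whose subsets are measurable, and the rest, where [K] vanishes. *)
Lemma lipschitz_kernel_measurable : measurable_fun setT K.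
Proof.
pose E := [set x | x \in [:: fine A; fine B]].
have countE (D : set R) : D `<=` E -> measurable D.
  move=> DE; apply: countable_measurable => [t|]; first exact: measurable_set1.
  apply: sub_countable (subset_card_le DE) _.
  exact/finite_set_countable/finite_seq.
have mE : measurable E by exact: countE.
have mS := open_measurable (@ereal_itv_open _ A B).
pose Z := ~` (ereal_itv A B `|` E).
have mZ : measurable Z by apply: measurableC; exact: measurableU.
have -> : [set: R] = ereal_itv A B `|` (E `|` Z).
  by apply/esym; rewrite setUA /Z setUv.
apply/measurable_funU => //; first exact: measurableU.
split.
  apply: open_continuous_measurable_fun; first exact: ereal_itv_open.
  exact: K_continuous.
apply/measurable_funU => //; split.
  by move=> _ Y _; apply: countE => x [].
apply: (eq_measurable_fun (cst (0 : R))); last exact: measurable_cst.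
move=> x; rewrite inE => Zx /=; have [Ex|Sx|->//] := K_cases x.
- by case: Zx; right.
- by case: Zx; left.
Qed.

Lemma lipschitz_kernel_sqr_integrable (g : R) : 0 < g ->
  (\int[leb]_x (`|K x| * `|x| `^ g)%R%:E < +oo)%E ->
  K x * `|x| `^ (g + 1) @[x --> +oo] --> 0 ->
  K x * `|x| `^ (g + 1) @[x --> -oo] --> 0 ->
  (\int[leb]_x (K x ^+ 2)%:E < +oo)%E.
Proof.
move=> g0 iK Kp Kn; have [c [k [c0 k0 Kck]]] := lipschitz_kernel_growth.
have mK := lipschitz_kernel_measurable.
have [N N1 KN] : exists2 N : R, 1 <= N &
    forall x, N < `|x| -> `|K x * `|x| `^ (g + 1)| <= 1.
  have /cvgrPdist_le/(_ 1 ltr01)[N1 [_ KN1]] := Kp.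
  have /cvgrPdist_le/(_ 1 ltr01)[N2 [_ KN2]] := Kn.
  (* [N1] and [- N2] serve the two tails; the lower bound 1 makes powers of [|x|] with nonnegative
     exponent at least 1 beyond [N]. *)
  exists (Num.max 1 (Num.max N1 (- N2))); first by rewrite le_max lexx.
  move=> x; rewrite !gt_max => /and3P[_ N1x N2x].
  have [x0|x0] := leP 0 x.
    by rewrite -normrN -[- _]sub0r; apply: KN1; rewrite -(ger0_norm x0).
  rewrite -normrN -[- _]sub0r; apply: KN2.
  by rewrite -ltrN2 -(ltr0_norm x0).
pose D := `[- N, N]%classic : set R.
have mD : measurable D by exact: measurable_itv.
have Dfin : (leb D < +oo)%E.
  by rewrite lebesgue_measure_itv/=; case: ifP; rewrite -?EFinD ltry.
pose M := (c + k * N) ^+ 2.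
(* An integrable majorant: the growth bound is used on [D], and the decay of [K] outside it. *)
have ub x : K x ^+ 2 <= M * \1_D x + `|K x| * `|x| `^ g.
  rewrite -real_normK ?num_real//; have [xN|Nx] := leP `|x| N.
    have -> : \1_D x = 1 :> R by rewrite indicE mem_set// /D/= in_itv/= -ler_norml.
    rewrite mulr1 ler_wpDr ?mulr_ge0 ?powR_ge0// lerXn2r ?nnegrE//.
      by rewrite addr_ge0// mulr_ge0// (le_trans ler01).
    by rewrite (le_trans (Kck x))// lerD2l ler_wpM2l.
  apply: ler_wpDl; first by rewrite mulr_ge0 ?sqr_ge0// indicE.
  rewrite expr2 ler_wpM2l//.
  have x1 : 1 <= `|x| by rewrite (le_trans N1)// ltW.
  have xg (r : R) : 0 <= r -> 1 <= `|x| `^ r.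
    by move=> r0; rewrite -(powRr0 `|x|) ler_powR.
  (* The chain is |K x| <= |K x| |x|^(g+1) <= 1 <= |x|^g. *)
  apply: le_trans (xg _ (ltW g0)); apply: le_trans (KN _ Nx).
  by rewrite normrM ler_peMr// ger0_norm ?powR_ge0// xg// addr_ge0// ltW.
have mI : measurable_fun setT (fun x => `|K x| * `|x| `^ g).
  apply: measurable_funM; first exact: measurableT_comp.
  exact: (measurableT_comp (measurable_powR g)).
apply: (@le_lt_trans _ _
  (\int[leb]_x ((M * \1_D x)%:E + (`|K x| * `|x| `^ g)%:E))%E).
  apply: ge0_le_integral => //.
  - by move=> x _; rewrite lee_fin sqr_ge0.
  - by apply/measurable_EFinP/measurable_funX.
  - apply: emeasurable_funD; last exact/measurable_EFinP.
    by apply/measurable_EFinP; apply: measurable_funM.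
  - by move=> x _; rewrite -EFinD lee_fin.
rewrite ge0_integralD//=.
- rewrite lte_add_pinfty//.
  under eq_integral do rewrite EFinM.
  rewrite ge0_integralZl//=; last 2 first.
  + exact/measurable_EFinP/measurable_indic.
  + by rewrite lee_fin sqr_ge0.
  by rewrite integral_indic// setIT lte_mul_pinfty// lee_fin sqr_ge0.
- by move=> x _; rewrite lee_fin mulr_ge0 ?sqr_ge0.
- by apply/measurable_EFinP; exact: measurable_funM.
- exact/measurable_EFinP.
Qed.

Lemma lipschitz_kernel_sqr_gt0 :
  (\int[leb]_x (K x)%:E = 1)%E -> (0 < \int[leb]_x (K x ^+ 2)%:E)%E.
Proof.
have mK := lipschitz_kernel_measurable.
move=> intK1; rewrite lt0e integral_ge0 ?andbT; last first.
  by move=> x _; rewrite lee_fin sqr_ge0.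
apply/eqP => intK0.
have : (\int[leb]_x `|(K x ^+ 2)%:E| = 0)%E.
  rewrite -[RHS]intK0; apply: eq_integral => x _.
  by rewrite /= ger0_norm// sqr_ge0.
move/ae_eq_integral_abs => /(_ measurableT).
have mK2 : measurable_fun setT (EFin \o (fun x => K x ^+ 2)).
  by apply/measurable_EFinP; exact: measurable_funX.
move=> /(_ mK2) K20.
have : (\int[leb]_x (K x)%:E = \int[leb]_x (cst 0 x))%E.
  apply: ae_eq_integral => //; first exact/measurable_EFinP.
  apply: filterS K20 => x /= /(_ I) [] /eqP; rewrite expf_eq0/= => /eqP Kx _.
  by rewrite Kx.
by rewrite intK1 integral0 => /eqP; rewrite onee_eq0.
Qed.

End KernelSquare.

(** * Finiteness of the fourth moment *)

Lemma adapted_measurable (d : measure_display) (Omega : measurableType d)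
    (R : realType) (P : probability Omega R) (F : R -> set (set Omega))
    (X : R -> Omega -> R) (t : R) :
  complete_filtration P F -> adapted F X -> 0 <= t -> measurable_fun setT (X t).
Proof. by move=> [_ FM _ _] aX t0 _ S mS; rewrite setTI; exact/(FM t)/aX. Qed.

(** The moment bound controls the expectation of the sum [mu ^+ 4 + sigma ^+ 4], which dominates
    [sigma ^+ 4] pointwise. *)
Lemma fourth_moment_lty (d : measure_display) (Omega : measurableType d)
    (R : realType) (P : probability Omega R) (T : R)
    (mu sigma : R -> Omega -> R) (t : R) :
  measurable_fun setT (mu t) -> measurable_fun setT (sigma t) ->
  moment_bound P T mu sigma -> t \in `[0, T] ->
  ('E_P[fun w => (sigma t w ^+ 4)%R] < +oo)%E.
Proof.
move=> mmu msigma [M _ +] tT => /(_ t tT) ltM.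
apply: le_lt_trans (lt_trans ltM (ltry M)).
have ge0 (x : R) : 0 <= x ^+ 4 by rewrite exprn_even_ge0.
apply: expectation_le => [||w|w|].
- exact: measurable_funX.
- by apply: measurable_funD; exact: measurable_funX.
- exact: ge0.
- by rewrite addr_ge0.
- by apply: aeW => w; rewrite lerDr.
Qed.

(** * Reduction of the approximated MSE to the two-term objective *)

Unset Implicit Arguments.

Theorem proposition3p1 (d : measure_display) (Omega : measurableType d)
  (R : realType) (P : probability Omega R) (F : R -> set (set Omega))
  (T : R) (mu sigma B X : R -> Omega -> R)
  (gamma : R) (L : R -> R) (C : R -> R -> R) (K : R -> R) (tau : R) (n : nat)
  (hF : complete_filtration P F)
  (hmu : adapted F mu) (hsigma : adapted F sigma)
  (hB : brownian_motion P F B)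
  (hX : ito_process P F B T mu sigma X)
  (hlev : non_leverage P mu sigma B)
  (hmom : moment_bound P T mu sigma)
  (hscal : scaling_condition P T sigma gamma L C)
  (hK : admissible_kernel gamma C K)
  (htau : tau \in `]0, T[)
  (hpos : (0 < 'E_P[fun w => (sigma tau w ^+ 4)%R])%E)
  (hn : (0 < n)%N) :
  let MSE := approx_MSE P T sigma gamma L C K tau n in
  let a := 2 * T * fine 'E_P[fun w => (sigma tau w ^+ 4)%R]
             * \int[lebesgue_measure]_x (K x ^+ 2) in
  let b := gamma * L tau * kernel_form K C in
  let hopt := n%:R `^ (- (1 / (gamma + 1))) * (a / b) `^ (1 / (gamma + 1)) in
  [/\ 0 < hopt,
      forall h, 0 < h -> h != hopt -> MSE hopt < MSE h &
      MSE hopt = n%:R `^ (- (gamma / (1 + gamma))) * (1 + 1 / gamma)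
                 * a `^ (gamma / (1 + gamma)) * b `^ (1 / (1 + gamma))].
Proof.
move=> MSE a b hopt.
move: (htau); rewrite in_itv/= => /andP[tau0 tauT].
have T0 : 0 < T by exact: lt_trans tauT.
have [g0 L0 _ _ _] := hscal.
have [K1 [A [B' [A0 B0 suppK lipK _]]] [Kg [Kp Kn] _ _] form0] := hK.
have m4 : ('E_P[fun w => (sigma tau w ^+ 4)%R] < +oo)%E.
  apply: (@fourth_moment_lty _ _ _ _ T mu) => //.
  - exact: (adapted_measurable _ hF hmu (ltW tau0)).
  - exact: (adapted_measurable _ hF hsigma (ltW tau0)).
  - by rewrite in_itv/= !ltW.
have K2_gt0 : 0 < \int[lebesgue_measure]_x (K x ^+ 2).
  (* The real integral is [fine] of the extended one and [fine] sends +oo to 0, so positivity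
     requires finiteness as well. *)
  apply: fine_gt0; rewrite (lipschitz_kernel_sqr_gt0 _ suppK lipK K1)/=.
  exact: (lipschitz_kernel_sqr_integrable _ A0 B0 suppK lipK _ g0 Kg Kp Kn).
have a0 : 0 < a by rewrite !mulr_gt0//; apply/fine_gt0/andP.
have b0 : 0 < b by rewrite !mulr_gt0// L0.
have n0 : 0 < n%:R :> R by rewrite ltr0n.
have p0 : 0 < a / n%:R by rewrite divr_gt0.
have n_powN r : n%:R `^ (- r) = n%:R^-1 `^ r :> R.
  by rewrite -(powR_inv1 (ltW n0)) -powRrM mulN1r.
have hoptE : hopt = (a / n%:R / b) `^ (1 / (gamma + 1)).
  rewrite /hopt n_powN -powRM ?invr_ge0 ?divr_ge0 ?ltW//.
  by rewrite mulrCA mulrA.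
(* The sample size enters only through [p = a / n]; the factor [gamma] built into [b] is divided out
   again. *)
have MSEE h : 0 < h -> MSE h = a / n%:R / h + b / gamma * h `^ gamma.
  move=> h0; rewrite /MSE /approx_MSE /a /b; field.
  by rewrite !gt_eqF.
have hopt0 : 0 < hopt by rewrite hoptE powR_gt0// divr_gt0.
split => // [h h0 hh|].
  rewrite !MSEE// hoptE; apply: bandwidth_min => //.
  by rewrite -hoptE.
rewrite MSEE// hoptE bandwidth_min_value//.
rewrite n_powN [a / _]mulrC powRM ?invr_ge0 ?ltW//.
by rewrite !mulrA; congr (_ * _ * _); rewrite mulrC.
Qed.
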